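(* Let $q\colon M\to N$ be a surjective monoid homomorphism, let $\mathbf{K}$ be an order-enriched category whose hom-posets admit arbitrary non-empty suprema and whose composition preserves them in each argument (i.e. $f\circ(\bigvee_i g_i)=\bigvee_i f\circ g_i$ and $(\bigvee_i g_i)\circ f=\bigvee_i g_i\circ f$ for non-empty families), and let $J\colon\mathbf{J}\to\mathbf{K}$ exhibit a wide subcategory. Then for every $\pi\in[\mathbf{M},\mathbf{K}]^J$ and every $n\in N$, $$\Sigma_q(\pi)_n=\bigvee\{\pi_m\mid m\in M,\ q(m)=n\}.$$
   Context: Order-enriched category: hom-sets partially ordered, composition monotone. A monoid $M$ is regarded as a one-object category $\mathbf{M}$. A lax functor $\pi$ from $\mathbf{M}$ to $\mathbf{K}$ is an object $\pi(\ast)$ with endomorphisms $\pi_m$ ($m\in M$) satisfying $id_{\pi(\ast)}\leq\pi_1$ and $\pi_m\circ\pi_{m'}\leq\pi_{m\cdot m'}$. $[\mathbf{M},\mathbf{K}]^J$ denotes the category of such lax functors with morphisms $\pi\to\pi'$ the morphisms $f\colon\pi(\ast)\to\pi'(\ast)$ of $\mathbf{J}$ with $J(f)\circ\pi_m\leq\pi'_m\circ J(f)$ for all $m$. The $q$-saturation $\Sigma_q(\pi)$ of $\pi\in[\mathbf{M},\mathbf{K}]^J$ is the lax functor from $\mathbf{N}$ with $\Sigma_q(\pi)(\ast)=\pi(\ast)$ and $\Sigma_q(\pi)_n=\bigvee_{i<\omega}\Pi_{n,i}$, where $\Pi_{n,0}=\bigvee\{\pi_m\mid q(m)=n\}$ and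 $\Pi_{n,i+1}=\bigvee\{\Pi_{n_1,i}\circ\cdots\circ\Pi_{n_l,i}\mid l\ge1,\ n_1\cdot\ldots\cdot n_l=n\}$ (this is a left strict 2-adjoint to the change-of-base functor $\pi'\mapsto\pi'\circ q$). *)

(* Defs.v *)
From mathcomp Require Import all_boot all_order.
From mathcomp Require Import boolp classical_sets.

Set Implicit Arguments.
Unset Strict Implicit.
Unset Printing Implicit Defensive.

Import Order.TTheory.

Local Open Scope classical_set_scope.

Reserved Notation "g \oc f" (at level 50, left associativity).

(* The library's monoidType and porderType carry a choiceType structure, which
   is no restriction on the carriers: boolp equips every type with one. *)

Record category := Category {
  obj : Type;
  hom : obj -> obj -> Type;
  idm : forall X, hom X X;
  comp : forall X Y Z, hom Y Z -> hom X Y -> hom X Z;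
  comp1m : forall X Y (f : hom X Y), comp (idm Y) f = f;
  compm1 : forall X Y (f : hom X Y), comp f (idm X) = f;
  compmA : forall X Y Z W (h : hom Z W) (g : hom Y Z) (f : hom X Y),
    comp h (comp g f) = comp (comp h g) f }.

Record ordCategory := OrdCategory {
  oobj :> Type;
  odisp : Order.disp_t;
  ohom : oobj -> oobj -> porderType odisp;
  oid : forall X, ohom X X;
  ocomp : forall X Y Z, ohom Y Z -> ohom X Y -> ohom X Z;
  ocomp1m : forall X Y (f : ohom X Y), ocomp (oid Y) f = f;
  ocompm1 : forall X Y (f : ohom X Y), ocomp f (oid X) = f;
  ocompA : forall X Y Z W (h : ohom Z W) (g : ohom Y Z) (f : ohom X Y),
    ocomp h (ocomp g f) = ocomp (ocomp h g) f;
  ocomp_le : forall X Y Z (g g' : ohom Y Z) (f f' : ohom X Y),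
    (g <= g')%O -> (f <= f')%O -> (ocomp g f <= ocomp g' f')%O }.

Arguments oid {o} X.
Arguments ocomp {o X Y Z}.

Notation "g \oc f" := (ocomp g f).

(* A wide subcategory has all the objects of K, so it is determined by the
   morphisms it contains; the functor J is the inclusion. *)
Record wideSubcat (K : ordCategory) := WideSubcat {
  wmor : forall X Y : K, set (ohom X Y);
  wmor_id : forall X, wmor (oid X);
  wmor_comp : forall X Y Z (g : ohom Y Z) (f : ohom X Y),
    wmor g -> wmor f -> wmor (g \oc f) }.

Arguments wmor {K} w {X Y}.

Record laxFunctor (M : monoidType) (K : ordCategory) := LaxFunctor {
  lobj : K;
  lmap :> M -> ohom lobj lobj;
  lax_id : (oid lobj <= lmap 1%g)%O;
  lax_comp : forall m m', (lmap m \oc lmap m' <= lmap (m * m')%g)%O }.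

Section LaxCategory.
Variables (M : monoidType) (K : ordCategory) (J : wideSubcat K).
Implicit Types p r s : laxFunctor M K.

Record laxMor p r := LaxMor {
  lmor :> ohom (lobj p) (lobj r);
  lmor_in : wmor J lmor;
  lmor_lax : forall m, (lmor \oc p m <= r m \oc lmor)%O }.

Lemma laxMor_inj p r (f g : laxMor p r) : lmor f = lmor g -> f = g.
Proof.
case: f g => [f fJ fl] [g gJ gl] /= efg; subst g.
by rewrite (Prop_irrelevance fJ gJ) (Prop_irrelevance fl gl).
Qed.

Lemma lax_id_subproof p m : (oid (lobj p) \oc p m <= p m \oc oid (lobj p))%O.
Proof. by rewrite ocomp1m ocompm1. Qed.

Definition laxId p : laxMor p p := LaxMor (wmor_id J _) (@lax_id_subproof p).

Lemma lax_comp_subproof p r s (g : laxMor r s) (f : laxMor p r) m :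
  ((g \oc f) \oc p m <= s m \oc (g \oc f))%O.
Proof.
have le_g : (g \oc (f \oc p m) <= g \oc (r m \oc f))%O.
  exact: ocomp_le (lexx _) (lmor_lax f m).
rewrite -ocompA; apply: le_trans le_g _; rewrite !ocompA.
exact: ocomp_le (lmor_lax g m) (lexx _).
Qed.

Definition laxComp p r s (g : laxMor r s) (f : laxMor p r) : laxMor p s :=
  LaxMor (wmor_comp (lmor_in g) (lmor_in f)) (lax_comp_subproof g f).

Lemma laxComp1m p r (f : laxMor p r) : laxComp (laxId r) f = f.
Proof. exact/laxMor_inj/ocomp1m. Qed.

Lemma laxCompm1 p r (f : laxMor p r) : laxComp f (laxId p) = f.
Proof. exact/laxMor_inj/ocompm1. Qed.

Lemma laxCompA p r s t (h : laxMor s t) (g : laxMor r s) (f : laxMor p r) :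
  laxComp h (laxComp g f) = laxComp (laxComp h g) f.
Proof. exact/laxMor_inj/ocompA. Qed.

(* [M, K]^J *)
Definition laxCat : category := Category laxComp1m laxCompm1 laxCompA.

End LaxCategory.

Definition has_nonempty_sups (K : ordCategory) : Prop :=
  forall (X Y : K) (E : set (ohom X Y)), E !=set0 -> exists s, isLub E s.

Section Sup.
Variables (K : ordCategory) (Ksup : has_nonempty_sups K) (X Y : K).
Implicit Types E : set (ohom X Y).

(* There is no supremum of the empty set to fall back on (hom-posets may be
   empty), hence the nonemptiness argument. *)
Definition sup E (neE : E !=set0) : ohom X Y := sval (cid (Ksup neE)).

Lemma supP E (neE : E !=set0) : isLub E (sup neE).
Proof. exact: svalP (cid (Ksup neE)). Qed.

Lemma sup_ub E (neE : E !=set0) f : E f -> (f <= sup neE)%O.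
Proof. by move=> Ef; apply: (proj1 (supP neE)). Qed.

Lemma sup_le E (neE : E !=set0) g :
  (forall f, E f -> (f <= g)%O) -> (sup neE <= g)%O.
Proof. by move=> Eg; apply: (proj2 (supP neE)). Qed.

End Sup.

Record comp_preserves_sups (K : ordCategory) (Ksup : has_nonempty_sups K) :
    Prop := CompPreservesSups {
  comp_supr : forall (X Y Z : K) (f : ohom Y Z) (E : set (ohom X Y))
      (neE : E !=set0),
    f \oc sup Ksup neE = sup Ksup (image_nonempty (fun g => f \oc g) neE);
  comp_supl : forall (X Y Z : K) (f : ohom X Y) (E : set (ohom Y Z))
      (neE : E !=set0),
    sup Ksup neE \oc f = sup Ksup (image_nonempty (fun g => g \oc f) neE) }.

Section Saturation.
Variables (M N : monoidType) (q : UMagmaMorphism.type M N).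
Hypothesis q_surj : forall n, exists m, q m = n.
Variables (K : ordCategory) (Ksup : has_nonempty_sups K).
Hypothesis Kcomp : comp_preserves_sups Ksup.

(* {pi_m | q(m) = n} *)
Definition fibre (p : laxFunctor M K) (n : N) :
    set (ohom (lobj p) (lobj p)) :=
  [set p m | m in [set m | q m = n]].

Arguments fibre : clear implicits.

Lemma fibre_nonempty p n : fibre p n !=set0.
Proof. by have [m qm] := q_surj n; exists (p m), m. Qed.

(* {F_{n_1} o ... o F_{n_l} | l >= 1, n_1 ... n_l = n}; the iterated
   composition ends with an identity, absorbed by the unit law. *)
Definition composites (X : K) (F : N -> ohom X X) (n : N) : set (ohom X X) :=
  [set \big[ocomp/oid X]_(x <- s) F x
     | s in [set s : seq N | s <> [::] /\ (\prod_(x <- s) x)%g = n]].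

Arguments composites : clear implicits.

Lemma composites1 X (F : N -> ohom X X) n : composites _ F n (F n).
Proof.
exists [:: n]; last by rewrite unlock /= ocompm1.
by split=> //; rewrite big_seq1.
Qed.

Lemma composites_nonempty X (F : N -> ohom X X) n : composites _ F n !=set0.
Proof. by exists (F n); apply: composites1. Qed.

Lemma composites2 X (F : N -> ohom X X) n n' :
  composites _ F (n * n')%g (F n \oc F n').
Proof.
exists [:: n; n']; last by rewrite unlock /= ocompm1.
by split=> //; rewrite big_cons big_seq1.
Qed.

Fixpoint satur_approx (p : laxFunctor M K) (i : nat) :
    N -> ohom (lobj p) (lobj p) :=
  if i is j.+1 then
    fun n => sup Ksup (composites_nonempty (satur_approx p j) n)
  else fun n => sup Ksup (fibre_nonempty p n).

Definition satur_approxs p n := [set satur_approx p i n | i in [set: nat]].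

Arguments satur_approxs : clear implicits.

Lemma satur_approxs_nonempty p n : satur_approxs p n !=set0.
Proof. by exists (satur_approx p 0 n), 0. Qed.

Definition satur_map p (n : N) : ohom (lobj p) (lobj p) :=
  sup Ksup (satur_approxs_nonempty p n).

Lemma satur_approx_le p n :
  {homo satur_approx p ^~ n : i j / i <= j >-> (i <= j)%O}.
Proof.
apply: (@homo_leq _ _ <=%O) => // [? ? ?|i]; first exact: le_trans.
exact/sup_ub/composites1.
Qed.

Lemma satur_map_ub p i n : (satur_approx p i n <= satur_map p n)%O.
Proof. by apply: sup_ub; exists i. Qed.

Lemma satur_id p : (oid (lobj p) <= satur_map p 1%g)%O.
Proof.
apply: le_trans (satur_map_ub p 0 1%g); apply: (le_trans (lax_id p)).
by apply: sup_ub; exists 1%g => //=; apply: gmulf1.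
Qed.

Lemma satur_comp p n n' :
  (satur_map p n \oc satur_map p n' <= satur_map p (n * n')%g)%O.
Proof.
rewrite {1}/satur_map (comp_supl Kcomp); apply: sup_le => _ [_ [i _ <-] <-].
rewrite /satur_map (comp_supr Kcomp); apply: sup_le => _ [_ [j _ <-] <-].
apply: le_trans (satur_map_ub p (maxn i j).+1 (n * n')%g).
apply: (@le_trans _ _ (satur_approx p (maxn i j) n \oc
                        satur_approx p (maxn i j) n')).
  by apply: ocomp_le; apply: satur_approx_le; rewrite (leq_maxl, leq_maxr).
exact/sup_ub/composites2.
Qed.

Definition saturation_lax (p : laxFunctor M K) : laxFunctor N K :=
  LaxFunctor (satur_id p) (satur_comp p).

(* Sigma_q *)
Definition saturation (J : wideSubcat K) (p : obj (laxCat M J)) :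
    obj (laxCat N J) :=
  saturation_lax p.

End Saturation.

(* Main.v *)
(** The family of fibre suprema is already lax over [N]: composing two of them
    gives, by distributivity, the supremum of the [pi_m \oc pi_m'], each of which
    lies below [pi_(m * m')]. Hence every iterated composite of approximants stays
    below the fibre supremum over the product, and the saturation stops at its
    zeroth stage. *)
Require Import Defs.
From mathcomp Require Import all_boot all_order.
From mathcomp Require Import boolp classical_sets.

Set Implicit Arguments.
Unset Strict Implicit.
Unset Printing Implicit Defensive.

Import Order.TTheory.

(** Induction on the word [s]: the iterated composite ends with an identity, so the base case is the
    empty word, settled by the unit inequality for [G]. *)
Lemma big_ocomp_le (N : monoidType) (K : ordCategory) (X : K)
    (F G : N -> ohom X X) (s : seq N) :
  (oid X <= G 1%g)%O ->
  (forall n n', (G n \oc G n' <= G (n * n')%g)%O) ->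
  (forall n, (F n <= G n)%O) ->
  (\big[ocomp/oid X]_(x <- s) F x <= G (\prod_(x <- s) x)%g)%O.
Proof.
move=> G1 GM leFG; elim: s => [|x s IHs]; first by rewrite !big_nil.
by rewrite !big_cons; apply: le_trans (GM _ _); apply: ocomp_le.
Qed.

Section FibreSup.
Variables (M N : monoidType) (q : UMagmaMorphism.type M N).
Hypothesis q_surj : forall n : N, exists m : M, q m = n.
Variables (K : ordCategory) (Ksup : has_nonempty_sups K).
Hypothesis Kcomp : comp_preserves_sups Ksup.
Variable p : laxFunctor M K.

Let fibre_sup (n : N) := sup Ksup (fibre_nonempty q_surj p n).

Lemma fibre_sup_id : (oid (lobj p) <= fibre_sup 1%g)%O.
Proof.
by apply: le_trans (lax_id p) _; apply: sup_ub; exists 1%g => //=; apply: gmulf1.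
Qed.

Lemma fibre_sup_comp n n' :
  (fibre_sup n \oc fibre_sup n' <= fibre_sup (n * n')%g)%O.
Proof.
rewrite {1}/fibre_sup (comp_supl Kcomp); apply: sup_le => _ [_ [m qm <-] <-].
rewrite {1}/fibre_sup (comp_supr Kcomp); apply: sup_le => _ [_ [m' qm' <-] <-].
apply: le_trans (lax_comp p m m') _; apply: sup_ub; exists (m * m')%g => //=.
by rewrite gmulfM qm qm'.
Qed.

Lemma satur_approx_le_fibre_sup i n :
  (satur_approx q_surj Ksup p i n <= fibre_sup n)%O.
Proof.
(* [n] stays general, since the factors of a composite over [n] may lie over other elements of
   [N]. *)
elim: i n => [|i IHi] n //=; apply: sup_le => _ [s [_ <-] <-].
exact: big_ocomp_le fibre_sup_id fibre_sup_comp IHi.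
Qed.

End FibreSup.

Theorem theorem4p3 (M N : monoidType) (q : UMagmaMorphism.type M N)
    (q_surj : forall n : N, exists m : M, q m = n)
    (K : ordCategory) (Ksup : has_nonempty_sups K)
    (Kcomp : comp_preserves_sups Ksup)
    (J : wideSubcat K) (pi : obj (laxCat M J)) (n : N) :
  lmap (saturation q_surj Kcomp pi) n = sup Ksup (fibre_nonempty q_surj pi n).
Proof.
(* The lower bound is stage 0 of the saturation, by definition the fibre supremum. *)
apply: le_anti; apply/andP; split; last exact: (satur_map_ub q_surj Ksup pi 0 n).
by apply: sup_le => _ [i _ <-]; apply: satur_approx_le_fibre_sup.
Qed.
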